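(* Let $G$ be a connected graph with nontrivial automorphism group whose motion $m(G)$ is uncountable. If $|\operatorname{Aut}(G)|\le m(G)$, then $D(G)=2$.
   Context: For an automorphism $\phi$, its motion $m(\phi)$ is the cardinality of the set of vertices not fixed by $\phi$. For a graph with nontrivial automorphism group, $m(G)=\min_{\phi\in\operatorname{Aut}(G)\setminus\{\mathrm{id}\}} m(\phi)$. The distinguishing number $D(G)$ is the least cardinal $d$ such that there is a labeling $V(G)\to X$ with $|X|=d$ preserved by no nontrivial automorphism of $G$. Graphs may have arbitrary cardinality. *)

(* Defs.v *)
From mathcomp Require Import all_boot.
From mathcomp Require Import boolp classical_sets functions cardinality.

Set Implicit Arguments.
Unset Strict Implicit.
Unset Printing Implicit Defensive.

Local Open Scope classical_set_scope.
Local Open Scope card_scope.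

(* Simple undirected graphs on an arbitrary, possibly infinite, type of
   vertices.  A boolean adjacency relation is no restriction, since
   propositions are decided classically in boolp. *)
Record sgraph (V : Type) := SGraph {
  adj :> rel V;
  adj_sym : symmetric adj;
  adj_irr : irreflexive adj }.

(* The walk is (x, p_1, ..., p_n), see path.v. *)
Definition connected_graph (V : Type) (G : sgraph V) : Prop :=
  forall x y : V, exists2 p : seq V, path G x p & last x p = y.

Definition Aut (V : Type) (G : sgraph V) : set (V -> V) :=
  [set phi | bijective phi /\ forall x y : V, G (phi x) (phi y) = G x y].

Definition nontrivial_Aut (V : Type) (G : sgraph V) : set (V -> V) :=
  Aut G `\ id.

Definition moved (V : Type) (phi : V -> V) : set V := [set x | phi x <> x].

(* A cardinal is represented by any set of that cardinality, and m(G) and D(G)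
   by predicates on such sets.  Each of them determines the set up to #=, by
   Cantor-Bernstein; see the end of this file for the existence of the two
   minima. *)
Definition is_motion (V : Type) (G : sgraph V) (T : Type) (M : set T) : Prop :=
  (exists2 phi, nontrivial_Aut G phi & moved phi #= M) /\
  (forall phi, nontrivial_Aut G phi -> M #<= moved phi).

Definition preserves (V X : Type) (phi : V -> V) (c : V -> X) : Prop :=
  forall x : V, c (phi x) = c x.

Definition distinguishing (V : Type) (G : sgraph V) (X : Type) (c : V -> X) :
    Prop :=
  forall phi, nontrivial_Aut G phi -> ~ preserves phi c.

Definition is_distinguishing_number (V : Type) (G : sgraph V)
    (T : Type) (D : set T) : Prop :=
  (exists (X : Type) (c : V -> X), [set: X] #= D /\ distinguishing G c) /\
  (forall (X : Type) (c : V -> X), distinguishing G c -> D #<= [set: X]).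

Lemma exists_min_card (I T : Type) (P : set I) (F : I -> set T) :
  P !=set0 -> exists2 i, P i & forall j, P j -> F i #<= F j.
Proof.
move=> [i0 Pi0].
pose Q (X : set (I -> T)) :=
  (forall g, X g -> forall i, P i -> F i (g i)) /\
  (forall g h i, X g -> X h -> P i -> g i = h i -> g = h).
have [|A [[AF Ainj] Amax]] := @Zorn_bigcup _ Q.
  move=> C CQ Ctot; split=> [g [X CX Xg]|g h i [X CX Xg] [Y CY Yh]].
    exact: (CQ X CX).1.
  have [XY|YX] := Ctot _ _ CX CY.
    by apply: (CQ Y CY).2 => //; exact: XY.
  by apply: (CQ X CX).2 => //; exact: YX.
have [i Pi Fi] : exists2 i, P i & F i `<=` (fun g => g i) @` A.
  apply: contrapT => noi.
  have /choice[y yP] : forall i, exists y, P i ->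
      F i y /\ forall g, A g -> g i <> y.
    have wit i : P i -> exists y, F i y /\ forall g, A g -> g i <> y.
      move=> Pi; apply: contrapT => noy; apply: noi; exists i => // y Fiy.
      apply: contrapT => nog; apply: noy; exists y; split=> // g Ag gy.
      by apply: nog; exists g.
    move=> i; have [Pi|nPi] := pselect (P i).
      by have [y yP] := wit i Pi; exists y.
    by have [y _] := wit i0 Pi0; exists y.
  apply: (Amax (A `|` [set y])).
    split; first exact: subsetUl.
    move=> /(_ y (or_intror erefl)) Ay.
    exact: ((yP i0 Pi0).2 y Ay).
  split=> [g [Ag|->] i Pi|g h i [Ag|->] [Ah|->] Pi //].
  - exact: AF.
  - exact: (yP i Pi).1.
  - exact: Ainj.
  - by move=> /((yP i Pi).2 g Ag).
  - by move=> /esym /((yP i Pi).2 h Ah).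
exists i => // j Pj.
apply: (card_le_trans (subset_card_le Fi)).
apply: (card_le_trans (card_image_le _ _)).
have ginj : {in A &, injective (fun g : I -> T => g j)}.
  by move=> g h /set_mem Ag /set_mem Ah; exact: Ainj.
have [f fE] := Pinj ginj.
rewrite -(card_le_eql (card_image f)) -fE; apply: subset_card_le.
by move=> _ [g Ag <-]; exact: AF.
Qed.

Lemma exists_motion (V : Type) (G : sgraph V) :
  nontrivial_Aut G !=set0 -> exists M : set V, is_motion G M.
Proof.
move=> /(@exists_min_card _ _ _ (@moved V))[phi Gphi phimin].
by exists (moved phi); split=> //; exists phi => //; exact: card_eqxx.
Qed.

Lemma exists_distinguishing_number (V : Type) (G : sgraph V) :
  exists D : set V, is_distinguishing_number G D.
Proof.
have idP : [set c : V -> V | distinguishing G c] !=set0.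
  by exists id => phi [_ ne] pres; apply: ne; exact/funext.
have [c Gc cmin] := exists_min_card (fun c : V -> V => range c) idP.
exists (range c); split=> [|X d Gd].
  exists (range c), (fun x => SigSub (mem_set (imageT c x))); split.
    exact: card_setT.
  by move=> phi /Gc + pres; apply=> x; have /(congr1 val) := pres x.
have rP x : exists y, d y = d x by exists x.
pose r (a : X) (H : exists y, d y = a) : V := sval (cid H).
pose e x := r (d x) (rP x).
have de x : d (e x) = d x by rewrite /e /r; case: cid.
have ed x y : d x = d y -> e x = e y.
  move=> dxy; rewrite /e; move: (rP x) (rP y); rewrite dxy => p q.
  by rewrite (Prop_irrelevance p q).
have Ge : distinguishing G e.
  by move=> phi /Gd + pres; apply=> x; rewrite -(de (phi x)) pres.
apply: (card_le_trans (cmin e Ge)).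
have dinj : {in range e &, injective d}.
  move=> _ _ /set_mem[x _ <-] /set_mem[y _ <-]; rewrite !de.
  exact: ed.
have [f fE] := Pinj dinj.
rewrite -(card_le_eql (card_image f)); exact: card_leT.
Qed.

(* Main.v *)
(* Well-order the nontrivial automorphisms so that every initial segment has
   fewer than |Aut(G)| <= m(G) elements.  By transfinite recursion choose for each
   phi_i a vertex x_i moved by phi_i such that x_i differs from all phi_j(x_j) and
   phi_i(x_i) from all x_j with j < i: fewer than m(G) vertices are forbidden and
   phi_i moves at least m(G).  Then no phi_i(x_i) is an x_j, so no phi_i preserves
   the set of the x_j, and its indicator function is distinguishing. *)
Require Import Defs.
From Stdlib Require Import Wellfounded.
From mathcomp Require Import all_boot.
From mathcomp Require Import boolp classical_sets functions cardinality wochoice.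

Local Open Scope classical_set_scope.
Local Open Scope card_scope.

Lemma card_le_inj (T U : Type) (A : set T) (B : set U) (f : T -> U) :
  set_fun A B f -> set_inj A f -> A #<= B.
Proof.
by move=> AB fI; have [g] := injfunPex.2 (ex_intro2 _ _ f AB fI); exact: inj_card_le.
Qed.

Lemma card_setX_bool_le (T : Type) (A : set T) :
  infinite_set A -> A `*` [set: bool] #<= A.
Proof.
elim/Ppointed: T => T in A *; first by move=> _; rewrite [A]empty_eq0 set0X.
move=> Ainf.
(* Q F: F is a family of disjoint copies of nat inside A.  A maximal such F covers
   A up to a finite, hence countable, remainder, so A is a union of |F| countable
   sets and A `*` setT is no larger than F `*` nat, which embeds into A. *)
pose Q (F : set (nat -> T)) :=
  (forall g, F g -> forall n, A (g n)) /\
  (forall g h m n, F g -> F h -> g m = h n -> g = h /\ m = n).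
have [F FQ Ftot|F [[FA Finj] Fmax]] := @Zorn_bigcup _ Q.
  split=> [g [X FX Xg]|g h m n [X FX Xg] [Y FY Yh]]; first exact: (FQ X FX).1.
  have [XY|YX] := Ftot _ _ FX FY.
    by apply: (FQ Y FY).2 => //; exact: XY.
  by apply: (FQ X FX).2 => //; exact: YX.
pose U := [set x | exists g n, F g /\ g n = x].
(* An infinite remainder would contain one more copy of nat, disjoint from those in [F], against
   maximality. *)
have Rfin : finite_set (A `\` U).
  apply: contrapT => /infiniteP/pcard_leP[h].
  have hR n : (A `\` U) (h n) by exact: funS.
  have hI : injective h by move=> m n; apply: inj; rewrite inE.
  have Fh : ~ F h by move=> Fh; apply: (hR 0).2; exists h, 0.
  apply: (Fmax (F `|` [set (h : nat -> T)])).
    split; first exact: subsetUl.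
    by move=> /(_ _ (or_intror erefl)).
  split=> [g [Fg|->] n|g k m n [Fg|->] [Fk|->]].
  - exact: FA.
  - exact: (hR n).1.
  - exact: Finj.
  - by move=> e; case: (hR n).2; exists g, m.
  - by move=> e; case: (hR m).2; exists k, n.
  - by move=> /hI.
have [g0 Fg0] : F !=set0.
  apply/set0P/eqP => F0; apply: Ainf; apply: sub_finite_set Rfin => x Ax.
  by split=> // -[g [n []]]; rewrite F0.
have /pcard_surjP[r rsurj] := finite_set_countable Rfin.
(* The number [p.2] codes a triple [(n, b, c)]: [b] tells whether [n] is an index into the copy
   [p.1] or into the enumeration [r] of the remainder, and [c] is the boolean coordinate. Numbers
   that code no triple get an arbitrary value. *)
pose s (p : (nat -> T) * nat) : T * bool :=
  if unpickle p.2 is Some (n, b, c) then (if b then p.1 n else r n, c)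
  else (g0 0, true).
have cover : A `*` [set: bool] `<=` s @` (F `*` [set: nat]).
  move=> [x c] [/= Ax _].
  have [[g [n [Fg gx]]]|Ux] := pselect (U x).
    by exists (g, pickle (n, true, c)); rewrite /s //= pickleK gx.
  have [n _ rx] := rsurj x (conj Ax Ux).
  by exists (g0, pickle (n, false, c)); rewrite /s //= pickleK rx.
apply: (card_le_trans (subset_card_le cover)).
apply: (card_le_trans (card_image_le _ _)).
apply: (@card_le_inj _ _ _ _ (fun p => p.1 p.2)) => [[g n] [Fg _]|[g m] [h n]].
  exact: FA.
by move=> /set_mem[/= Fg _] /set_mem[/= Fh _] /(Finj _ _ _ _ Fg Fh)[-> ->].
Qed.

Lemma well_founded_total_order (I : Type) : exists lt : I -> I -> Prop,
  well_founded lt /\ forall i j, i <> j -> lt i j \/ lt j i.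
Proof.
have [R wo] := well_ordering_principle {classic I}.
exists (fun i j => ~ R j i); split=> [i|i j ij].
  apply: contrapT => nAcc.
  have [|z [[/asboolP nz zmin] _]] :=
      wo (fun x => `[< ~ Acc (fun i j => ~ R j i) x >]).
    by exists i; apply/asboolP.
  apply: nz; constructor => y Rzy; apply: contrapT => ny.
  by apply: Rzy; apply: zmin; apply/asboolP.
apply: contrapT => /not_orP[/contrapT Rji /contrapT Rij]; apply: ij.
have refl (k : {classic I}) : R k k.
  have [|z [[/asboolP zk zmin] _]] := wo (fun x => `[< x = k >]).
    by exists k; apply/asboolP.
  by subst z; apply: zmin; apply/asboolP.
(* Now both [i] and [j] are minima of the pair, and minima are unique. *)
have [|z [_ zuniq]] := wo (fun x => `[< x = i \/ x = j >]).
  by exists i; apply/asboolP; left.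
have <- : z = i.
  by apply: zuniq; split=> [|x /asboolP[->|->]//]; apply/asboolP; left.
by apply: zuniq; split=> [|x /asboolP[->|->]//]; apply/asboolP; right.
Qed.

(* If some segment is as large as I, pull the order back along an injection of I
   into the least such segment. *)
Lemma initial_well_order (I : Type) : exists lt : I -> I -> Prop,
  [/\ well_founded lt, forall i j, i <> j -> lt i j \/ lt j i &
      forall i, ~ ([set: I] #<= [set j | lt j i])].
Proof.
elim/Ppointed: I => I; first by exists (fun _ _ => False); split=> i; have := no i.
have [lt [ltwf lttot]] := well_founded_total_order I.
have [small|/existsNP[i0 /contrapT big0]] :=
  pselect (forall i, ~ ([set: I] #<= [set j | lt j i])).
  by exists lt.
have [i big imin] : exists2 i, [set: I] #<= [set j | lt j i] &
    forall j, lt j i -> ~ ([set: I] #<= [set k | lt k j]).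
  apply: contrapT => nomin; move: big0.
  elim/(well_founded_ind ltwf): i0 => i IH big.
  by apply: nomin; exists i.
have /pcard_leP[g] := big.
have gI : injective g by move=> x y; apply: inj; rewrite inE.
exists (fun x y => lt (g x) (g y)); split.
- exact: wf_inverse_image.
- by move=> x y xy; apply: lttot => /gI.
- move=> x big'.
  have ltx : [set j | lt j i] (g x) by exact: funS.
  apply: (imin _ ltx); apply: (card_le_trans big').
  by apply: (@card_le_inj _ _ _ _ g) => // y z _ _; exact: gI.
Qed.

(** The recursion supplies only the values below [i]. Filling the others with [point] is harmless,
    since [P i] depends only on the values below [i]. *)
Lemma wf_choice (I : Type) (V : pointedType) (lt : I -> I -> Prop)
    (P : I -> (I -> V) -> V -> Prop) :
  well_founded lt ->
  (forall i f g x, (forall j, lt j i -> f j = g j) -> P i f x -> P i g x) ->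
  (forall i f, exists x, P i f x) ->
  exists f : I -> V, forall i, P i f (f i).
Proof.
move=> ltwf Pext ex.
pose extend i (rec : forall j, lt j i -> V) j :=
  if pselect (lt j i) is left ji then rec j ji else point.
pose step i rec := sval (cid (ex i (extend i rec))).
pose f := Fix ltwf (fun=> V) step.
exists f => i; have -> : f i = step i (fun j _ => f j).
  apply: (Fix_eq ltwf (fun=> V) step) => j g h gh; congr step.
  by apply/functional_extensionality_dep => k; apply/funext.
apply: Pext (svalP (cid (ex i _))) => j ji.
by rewrite /extend; case: pselect.
Qed.

Lemma exists_two_coloring (I V : Type) (phi : I -> V -> V) (T : Type) (M : set T) :
  infinite_set M -> [set: I] #<= M -> (forall i, bijective (phi i)) ->
  (forall i, M #<= moved (phi i)) ->
  exists c : V -> bool, forall i, ~ preserves (phi i) c.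
Proof.
elim/Ppointed: V => V in phi *.
  move=> Minf _ _ Mmoved; exists (fun=> true) => i _; apply: Minf.
  by move: (Mmoved i); rewrite card_le_emptyr => /eqP->; exact: finite_set0.
move=> Minf IM phibij Mmoved.
have [lt [ltwf lttot small]] := initial_well_order I.
pose P i (f : I -> V) x := phi i x <> x /\
  forall j, lt j i -> x <> phi j (f j) /\ phi i x <> f j.
have [f fP] : exists f, forall i, P i f (f i).
  apply: (wf_choice _ _ _ P ltwf) => [i f g x fg [mx Px]|i f].
    by split=> // j ji; rewrite -fg //; exact: Px.
  (* If every moved vertex is forbidden, each is some [phi j (f j)] or [psi (f j)] with [j] below
     [i]. Hence I <= M <= S * bool <= S, contradicting the choice of the order. *)
  apply: contrapT => noP; apply: (small i).
  have [psi phiK psiK] := phibij i.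
  pose S := [set j | lt j i].
  pose s (p : I * bool) := if p.2 then phi p.1 (f p.1) else psi (f p.1).
  have cover : moved (phi i) `<=` s @` (S `*` [set: bool]).
    move=> x mx; apply: contrapT => nx; apply: noP; exists x; split=> // j ji.
    split=> e; apply: nx; first by exists (j, true).
    by exists (j, false) => //; rewrite /s /= -e phiK.
  have MS : M #<= S `*` [set: bool].
    apply: (card_le_trans (Mmoved i)); apply: (card_le_trans (subset_card_le cover)).
    exact: card_image_le.
  have Sinf : infinite_set S.
    move=> Sfin; apply: Minf; apply: (card_le_finite MS).
    exact: finite_setX.
  apply: (card_le_trans IM); apply: (card_le_trans MS).
  exact: card_setX_bool_le.
(* Preservation would give [phi i (f i) = f j] for some [j]. The case [j = i] fails because [f i] is
   moved; otherwise the condition imposed at the later of the two indices is violated. *)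
exists (fun x => `[< exists i, f i = x >]) => i /(_ (f i)).
have -> : `[< exists j, f j = f i >] by apply/asboolP; exists i.
move=> /asboolP[j fj].
have [ij|ij] := pselect (i = j); first by apply: (fP i).1; rewrite -fj ij.
have [lij|lji] := lttot _ _ ij.
  by have [] := (fP j).2 i lij.
by have [_] := (fP i).2 j lji; rewrite fj.
Qed.

(** A nontrivial [phi] does not preserve [c], so some [x] and [phi x] carry two different labels. *)
Lemma distinguishing_ge2 (V : Type) (G : sgraph V) (X : Type) (c : V -> X) :
  nontrivial_Aut G !=set0 -> distinguishing G c -> `I_2 #<= [set: X].
Proof.
move=> [phi Gphi] /(_ phi Gphi)/existsNP[x cx].
apply: (@card_le_inj _ _ _ _ (fun n => if n is 0 then c x else c (phi x))) => //.
by move=> [|[|m]] [|[|n]] // /set_mem /= ? /set_mem /= ? // /esym.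
Qed.

Theorem theorem14 (V : Type) (G : sgraph V) (T : Type) (M : set T)
    (Gconn : connected_graph G)
    (Gnontriv : nontrivial_Aut G !=set0)
    (GM : is_motion G M)
    (Muncountable : ~ countable M)
    (AutM : Aut G #<= M) :
  is_distinguishing_number G `I_2.
Proof.
split; last by move=> X c; exact: distinguishing_ge2.
have Minf : infinite_set M by move=> /finite_set_countable.
have IM : [set: nontrivial_Aut G] #<= M.
  rewrite (card_le_eql (card_setT _)).
  by apply: card_le_trans AutM; apply: subset_card_le => phi [].
have [||c cP] := @exists_two_coloring _ V val T M Minf IM.
- by move=> [phi Gphi]; have [[]] := set_mem Gphi.
- by move=> [phi Gphi]; apply: GM.2; exact: set_mem Gphi.
exists bool, c; split=> [|phi Gphi]; last exact: (cP (SigSub (mem_set Gphi))).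
apply/card_set_bijP; exists nat_of_bool; split=> [[]//|[] []//|[|[|n]] // _].
  by exists false.
by exists true.
Qed.
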